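(* Let $\mathbb{X}$ be a basic reverse differential restriction category. For any map $g:A\times B\to C$ define $$g^{\dagger[A]}:=(\iota_0\times 1_C)\,R[g]\,\pi_1:A\times C\to B,$$ where $\iota_0=\langle 1_A,0\rangle:A\to A\times B$. For $f:A\to B$ define $D[f]:=R[f]^{\dagger[A]}=(\iota_0\times 1_A)R[R[f]]\pi_1:A\times A\to B$. Then $\mathbb{X}$ satisfies axiom [RD.6] if and only if $D[f]^{\dagger[A]}=R[f]$ for every map $f$, i.e. $$(\iota_0\times 1_B)\,R[D[f]]\,\pi_1=R[f]\quad\text{for all } f:A\to B,$$ where here $\iota_0=\langle 1_A,0\rangle:A\to A\times A$.
   Context: Composition is written in diagrammatic order: $fg$ means ''first $f$, then $g$''. A restriction category is a category with an operation sending each $f:A\to B$ to a map $\bar f:A\to A$ such that $\bar f f=f$, $\bar f\bar g=\bar g\bar f$ (for $f,g$ with common domain), $\overline{\bar f g}=\bar f\bar g$, and $f\bar g=\overline{fg}\,f$. A map $f$ is total if $\bar f=1$. The category has restriction products if: - there is an object $1$ with a total map $!_A:A\to 1$ for each $A$ such that every $f:A\to1$ equals $\bar f\,!_A$; - for all $A,B$ there is an object $A\times B$ with total maps $\pi_0,\pi_1$ such that for all $f:C\to A$, $g:C\to B$ there is a unique $\langle f,g\rangle$ with $\langle f,g\rangle\pi_0=\bar g f$ and $\langle f,g\rangle\pi_1=\bar f g$. Write $f\times g=\langle\pi_0f,\pi_1g\rangle$. A Cartesian left additive restriction category is a restriction category with restriction products in which every hom-set is a commutative monoid $(+,0)$ such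 that: - $\overline{f+g}=\bar f\bar g$ and $\bar 0=1$; - $x(f+g)=xf+xg$ and $x0=\bar x 0$; - $(f+g)\pi_i=f\pi_i+g\pi_i$ and $0\pi_i=0$. Write $\iota_0=\langle 1,0\rangle$ and $\iota_1=\langle 0,1\rangle$. A basic reverse differential restriction category is a Cartesian left additive restriction category with an operation sending each $f:A\to B$ to $R[f]:A\times B\to A$ satisfying: - [RD.1] $R[f+g]=R[f]+R[g]$ and $R[0]=0$. - [RD.2] $\langle a,b+c\rangle R[f]=\langle a,b\rangle R[f]+\langle a,c\rangle R[f]$ and $\langle a,0\rangle R[f]=\overline{af}\,0$. - [RD.3] $R[\pi_j]=\pi_1\iota_j$. - [RD.4] $R[\langle f,g\rangle]=(1\times\pi_0)R[f]+(1\times\pi_1)R[g]$. - [RD.5] $R[fg]=\langle\pi_0,\langle\pi_0f,\pi_1\rangle R[g]\rangle R[f]$. - [RD.8] $\overline{R[f]}=\bar f\times 1$. - [RD.9] $R[\bar f]=(\bar f\times1)\pi_1$. Axiom [RD.6] is: for all $f:A\to B$, $$\langle 1_A\times\pi_0,\,0\times\pi_1\rangle(\iota_0\times 1)R[R[R[f]]]\pi_1=(1_A\times\pi_1)R[f]$$ as maps $A\times(B\times B)\to A$, where $0:A\to A$. *)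

(* Defs.v *)
(* Plain Rocq (no library world needed): an axiomatic definition of
   basic reverse differential restriction categories.
   Composition is diagrammatic: [comp f g] means "first f, then g". *)

Set Implicit Arguments.

Record BRDRC := {
  ob : Type;
  hom : ob -> ob -> Type;
  idm : forall A, hom A A;
  comp : forall {A B C}, hom A B -> hom B C -> hom A C;
  comp_assoc : forall A B C D (f : hom A B) (g : hom B C) (h : hom C D),
      comp (comp f g) h = comp f (comp g h);
  comp_id_l : forall A B (f : hom A B), comp (idm A) f = f;
  comp_id_r : forall A B (f : hom A B), comp f (idm B) = f;

  rst : forall {A B}, hom A B -> hom A A;
  R1 : forall A B (f : hom A B), comp (rst f) f = f;
  R2 : forall A B C (f : hom A B) (g : hom A C),
      comp (rst f) (rst g) = comp (rst g) (rst f);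
  R3 : forall A B C (f : hom A B) (g : hom A C),
      rst (comp (rst f) g) = comp (rst f) (rst g);
  R4 : forall A B C (f : hom A B) (g : hom B C),
      comp f (rst g) = comp (rst (comp f g)) f;

  one : ob;
  bang : forall A, hom A one;
  bang_total : forall A, rst (bang A) = idm A;
  bang_unique : forall A (f : hom A one), f = comp (rst f) (bang A);

  prod : ob -> ob -> ob;
  pi0 : forall {A B}, hom (prod A B) A;
  pi1 : forall {A B}, hom (prod A B) B;
  pi0_total : forall A B, rst (@pi0 A B) = idm (prod A B);
  pi1_total : forall A B, rst (@pi1 A B) = idm (prod A B);
  pair : forall {A B C}, hom C A -> hom C B -> hom C (prod A B);
  pair_pi0 : forall A B C (f : hom C A) (g : hom C B),
      comp (pair f g) pi0 = comp (rst g) f;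
  pair_pi1 : forall A B C (f : hom C A) (g : hom C B),
      comp (pair f g) pi1 = comp (rst f) g;
  pair_unique : forall A B C (f : hom C A) (g : hom C B) (h : hom C (prod A B)),
      comp h pi0 = comp (rst g) f -> comp h pi1 = comp (rst f) g -> h = pair f g;

  plus : forall {A B}, hom A B -> hom A B -> hom A B;
  zero : forall A B, hom A B;
  plus_assoc : forall A B (f g h : hom A B), plus (plus f g) h = plus f (plus g h);
  plus_comm : forall A B (f g : hom A B), plus f g = plus g f;
  plus_zero : forall A B (f : hom A B), plus f (zero A B) = f;
  rst_plus : forall A B (f g : hom A B), rst (plus f g) = comp (rst f) (rst g);
  rst_zero : forall A B, rst (zero A B) = idm A;
  comp_plus : forall A B C (x : hom A B) (f g : hom B C),
      comp x (plus f g) = plus (comp x f) (comp x g);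
  comp_zero : forall A B C (x : hom A B), comp x (zero B C) = comp (rst x) (zero A C);
  plus_pi0 : forall A B C (f g : hom C (prod A B)),
      comp (plus f g) pi0 = plus (comp f pi0) (comp g pi0);
  plus_pi1 : forall A B C (f g : hom C (prod A B)),
      comp (plus f g) pi1 = plus (comp f pi1) (comp g pi1);
  zero_pi0 : forall A B C, comp (zero C (prod A B)) pi0 = zero C A;
  zero_pi1 : forall A B C, comp (zero C (prod A B)) pi1 = zero C B;

  Rd : forall {A B}, hom A B -> hom (prod A B) A;
  RD1_plus : forall A B (f g : hom A B), Rd (plus f g) = plus (Rd f) (Rd g);
  RD1_zero : forall A B, Rd (zero A B) = zero (prod A B) A;
  RD2_plus : forall A B C (f : hom A B) (a : hom C A) (b c : hom C B),
      comp (pair a (plus b c)) (Rd f)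
      = plus (comp (pair a b) (Rd f)) (comp (pair a c) (Rd f));
  RD2_zero : forall A B C (f : hom A B) (a : hom C A),
      comp (pair a (zero C B)) (Rd f) = comp (rst (comp a f)) (zero C A);
  RD3_0 : forall A B,
      Rd (@pi0 A B) = comp pi1 (pair (idm A) (zero A B));
  RD3_1 : forall A B,
      Rd (@pi1 A B) = comp pi1 (pair (zero B A) (idm B));
  RD4 : forall A B C (f : hom A B) (g : hom A C),
      Rd (pair f g)
      = plus (comp (pair (comp pi0 (idm A)) (comp pi1 pi0)) (Rd f))
             (comp (pair (comp pi0 (idm A)) (comp pi1 pi1)) (Rd g));
  RD5 : forall A B C (f : hom A B) (g : hom B C),
      Rd (comp f g) = comp (pair pi0 (comp (pair (comp pi0 f) pi1) (Rd g))) (Rd f);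
  RD8 : forall A B (f : hom A B),
      rst (Rd f) = pair (comp pi0 (rst f)) (comp pi1 (idm B));
  RD9 : forall A B (f : hom A B),
      Rd (rst f) = comp (pair (comp pi0 (rst f)) (comp pi1 (idm A))) pi1
}.

Arguments idm {_} A.
Arguments comp {_ A B C}.
Arguments rst {_ A B}.
Arguments one {_}.
Arguments bang {_} A.
Arguments prod {_}.
Arguments pi0 {_ A B}.
Arguments pi1 {_ A B}.
Arguments pair {_ A B C}.
Arguments plus {_ A B}.
Arguments zero {_} A B.
Arguments Rd {_ A B}.

Section Derived.
Context {X : BRDRC}.

Definition tensor {A B C D : ob X} (f : hom X A C) (g : hom X B D)
  : hom X (prod A B) (prod C D) := pair (comp pi0 f) (comp pi1 g).

Definition iota0 (A B : ob X) : hom X A (prod A B) := pair (idm A) (zero A B).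

Definition dagger {A B C : ob X} (g : hom X (prod A B) C) : hom X (prod A C) B :=
  comp (comp (tensor (iota0 A B) (idm C)) (Rd g)) pi1.

Definition Dd {A B : ob X} (f : hom X A B) : hom X (prod A A) B := dagger (Rd f).

Definition RD6 : Prop :=
  forall (A B : ob X) (f : hom X A B),
    comp (comp (comp (pair (tensor (idm A) (@pi0 _ B B)) (tensor (zero A A) (@pi1 _ B B)))
                     (tensor (iota0 (prod A B) A) (idm (prod A B))))
               (Rd (Rd (Rd f))))
         pi1
    = comp (tensor (idm A) (@pi1 _ B B)) (Rd f).

End Derived.
Arguments RD6 X : clear implicits.

(* Main.v *)
(* Write L_f : A x (B x B) -> A for the left-hand side of [RD.6], so that
   [RD.6] reads  L_f = (1 x pi1) R[f].  The proof rests on two facts: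

   (1) D[f]^{dagger[A]} = (1 x <0,1>) L_f  (lemma [dagger_Dd_factor]); it
       follows from [RD.5] and the formula R[g pi1] = <pi0, pi1 <0,1>> R[g].
   (2) L_f depends only on the last B-coordinate, L_f = (1 x pi1<0,1>) L_f
       (lemma [RD6_lhs_second_only]).  This holds in every basic reverse
       differential restriction category: R[f] is additive in its second
       argument by [RD.2], and differentiating this additivity shows that
       R[R[f]] pi1 ignores the linear argument of R[f].

   Then [RD.6] gives D[f]^dagger = (1 x <0,1>)(1 x pi1) R[f] = R[f] by (1),
   and conversely D[f]^dagger = R[f] gives, by (2) and (1),
   L_f = (1 x pi1)(1 x <0,1>) L_f = (1 x pi1) D[f]^dagger = (1 x pi1) R[f]. *)

Require Import Defs.
Set Implicit Arguments.
Unset Strict Implicit.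

Arguments comp_assoc {_ _ _ _ _} _ _ _.
Arguments comp_id_l {_ _ _} _.
Arguments comp_id_r {_ _ _} _.
Arguments R1 {_ _ _} _.
Arguments R2 {_ _ _ _} _ _.
Arguments R3 {_ _ _ _} _ _.
Arguments R4 {_ _ _ _} _ _.
Arguments pair_pi0 {_ _ _ _} _ _.
Arguments pair_pi1 {_ _ _ _} _ _.
Arguments pair_unique {_ _ _ _} _ _ _ _ _.
Arguments plus_comm {_ _ _} _ _.
Arguments plus_zero {_ _ _} _.
Arguments rst_plus {_ _ _} _ _.
Arguments comp_plus {_ _ _ _} _ _ _.
Arguments comp_zero {_ _ _ _} _.
Arguments plus_pi0 {_ _ _ _} _ _.
Arguments plus_pi1 {_ _ _ _} _ _.
Arguments zero_pi0 {_ _ _ _}.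
Arguments zero_pi1 {_ _ _ _}.
Arguments RD1_plus {_ _ _} _ _.
Arguments RD1_zero {_ _ _}.
Arguments RD2_plus {_ _ _ _} _ _ _ _.
Arguments RD2_zero {_ _ _ _} _ _.
Arguments RD3_0 {_ _ _}.
Arguments RD3_1 {_ _ _}.
Arguments RD4 {_ _ _ _} _ _.
Arguments RD5 {_ _ _ _} _ _.
Arguments RD8 {_ _ _} _.
Arguments RD9 {_ _ _} _.

Notation "f ;; g" := (comp f g) (at level 39, right associativity).

Definition total {X : BRDRC} {A B : ob X} (f : hom X A B) : Prop := rst f = idm A.

Section RestrictionProducts.
Context {X : BRDRC}.
Implicit Types A B C D E : ob X.

Lemma compA A B C D (f : hom X A B) (g : hom X B C) (h : hom X C D) :
  (f ;; g) ;; h = f ;; g ;; h.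
Proof. apply comp_assoc. Qed.

Lemma total_rst A B (f : hom X A B) : total f -> rst f = idm A.
Proof. auto. Qed.

Lemma rst_id A : rst (idm A) = idm A.
Proof. rewrite <- (comp_id_r (rst (idm A))). apply R1. Qed.

Lemma rst_idem A B (f : hom X A B) : rst f ;; rst f = rst f.
Proof. rewrite <- R3, R1. reflexivity. Qed.

Lemma rst_rst A B (f : hom X A B) : rst (rst f) = rst f.
Proof. pose proof (R3 f (idm A)) as H. rewrite comp_id_r, rst_id, comp_id_r in H. exact H. Qed.

Lemma rst_comp_rst A B C (f : hom X A B) (g : hom X B C) : rst (f ;; rst g) = rst (f ;; g).
Proof.
  rewrite R4, R3, R2, <- R3, <- compA, R1. reflexivity.
Qed.

Lemma rst_comp_total A B C (f : hom X A B) (g : hom X B C) : total g -> rst (f ;; g) = rst f.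
Proof. intro Hg. rewrite <- rst_comp_rst, Hg, comp_id_r. reflexivity. Qed.

Lemma total_comp A B C (f : hom X A B) (g : hom X B C) : total f -> total g -> total (f ;; g).
Proof. intros Hf Hg. unfold total. rewrite rst_comp_total; auto. Qed.

Lemma total_pi0 A B : total (@pi0 X A B). Proof. apply pi0_total. Qed.
Lemma total_pi1 A B : total (@pi1 X A B). Proof. apply pi1_total. Qed.
Lemma total_id A : total (idm A). Proof. apply rst_id. Qed.
Lemma total_zero A B : total (zero A B). Proof. apply rst_zero. Qed.

Lemma total_plus A B (f g : hom X A B) : total f -> total g -> total (plus f g).
Proof. intros Hf Hg. unfold total. rewrite rst_plus, Hf, Hg, comp_id_l. reflexivity. Qed.

Lemma rst_pair A B C (f : hom X C A) (g : hom X C B) : rst (pair f g) = rst f ;; rst g.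
Proof.
  rewrite <- (rst_comp_total (pair f g) (total_pi0 A B)), pair_pi0, R3, R2. reflexivity.
Qed.

Lemma total_pair A B C (f : hom X C A) (g : hom X C B) : total f -> total g -> total (pair f g).
Proof. intros Hf Hg. unfold total. rewrite rst_pair, Hf, Hg, comp_id_l. reflexivity. Qed.

Lemma pair_proj A B : pair (@pi0 X A B) pi1 = idm (prod A B).
Proof.
  symmetry. apply pair_unique; rewrite comp_id_l, ?pi0_total, ?pi1_total, comp_id_l; reflexivity.
Qed.

Lemma comp_pair A B C D (x : hom X D C) (f : hom X C A) (g : hom X C B) :
  x ;; pair f g = pair (x ;; f) (x ;; g).
Proof.
  apply pair_unique.
  - rewrite compA, pair_pi0, <- compA, R4, compA. reflexivity.
  - rewrite compA, pair_pi1, <- compA, R4, compA. reflexivity.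
Qed.

Lemma pair_eta A B C (h : hom X C (prod A B)) : pair (h ;; pi0) (h ;; pi1) = h.
Proof.
  symmetry. apply pair_unique.
  - rewrite (rst_comp_total h (total_pi1 A B)), <- compA, R1. reflexivity.
  - rewrite (rst_comp_total h (total_pi0 A B)), <- compA, R1. reflexivity.
Qed.

Lemma prod_ext A B C (h1 h2 : hom X C (prod A B)) :
  h1 ;; pi0 = h2 ;; pi0 -> h1 ;; pi1 = h2 ;; pi1 -> h1 = h2.
Proof. intros H0 H1. rewrite <- (pair_eta h1), <- (pair_eta h2), H0, H1. reflexivity. Qed.

Lemma comp_zero_total A B C (x : hom X A B) : total x -> x ;; zero B C = zero A C.
Proof. intro Hx. rewrite comp_zero, Hx, comp_id_l. reflexivity. Qed.

Lemma plus_zero_l A B (f : hom X A B) : plus (zero A B) f = f.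
Proof. rewrite plus_comm. apply plus_zero. Qed.

Lemma rst_zero_plus A B (y : hom X A B) : plus (rst y ;; zero A B) y = y.
Proof.
  rewrite plus_comm. transitivity (plus (rst y ;; y) (rst y ;; zero A B)).
  - rewrite R1. reflexivity.
  - rewrite <- comp_plus, plus_zero, R1. reflexivity.
Qed.

Lemma Rd_id A : Rd (idm A) = pi1.
Proof.
  pose proof (RD9 (idm A)) as H. rewrite rst_id, !comp_id_r, pair_proj, comp_id_l in H. exact H.
Qed.

Lemma total_Rd A B (f : hom X A B) : total f -> total (Rd f).
Proof. intro Hf. unfold total. rewrite RD8, Hf, !comp_id_r. apply pair_proj. Qed.

End RestrictionProducts.

(* Composites are kept right-nested by [compA]; so that the product and
   additive rules still fire inside longer composites, each is also stated
   with an arbitrary continuation [k]. *)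
Section ContinuationRules.
Context {X : BRDRC}.
Implicit Types A B C D E : ob X.

Lemma pair_pi0_k A B C D (f : hom X C A) (g : hom X C B) (k : hom X A D) :
  pair f g ;; pi0 ;; k = rst g ;; f ;; k.
Proof. rewrite <- compA, pair_pi0, compA. reflexivity. Qed.
Lemma pair_pi1_k A B C D (f : hom X C A) (g : hom X C B) (k : hom X B D) :
  pair f g ;; pi1 ;; k = rst f ;; g ;; k.
Proof. rewrite <- compA, pair_pi1, compA. reflexivity. Qed.
Lemma comp_pair_k A B C D E (x : hom X D C) (f : hom X C A) (g : hom X C B)
  (k : hom X (prod A B) E) : x ;; pair f g ;; k = pair (x ;; f) (x ;; g) ;; k.
Proof. rewrite <- compA, comp_pair. reflexivity. Qed.
Lemma zero_pi1_k A B C D (k : hom X B D) : zero C (prod A B) ;; pi1 ;; k = zero C B ;; k.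
Proof. rewrite <- compA, zero_pi1. reflexivity. Qed.
Lemma plus_pi1_k A B C D (f g : hom X C (prod A B)) (k : hom X B D) :
  plus f g ;; pi1 ;; k = plus (f ;; pi1) (g ;; pi1) ;; k.
Proof. rewrite <- compA, plus_pi1. reflexivity. Qed.
Lemma comp_plus_k A B C D (x : hom X A B) (f g : hom X B C) (k : hom X C D) :
  x ;; plus f g ;; k = plus (x ;; f) (x ;; g) ;; k.
Proof. rewrite <- compA, comp_plus. reflexivity. Qed.
Lemma comp_zero_total_k A B C D (x : hom X A B) (k : hom X C D) :
  total x -> x ;; zero B C ;; k = zero A C ;; k.
Proof. intro Hx. rewrite <- compA, comp_zero_total; auto. Qed.
Lemma rst_idem_k A B C (f : hom X A B) (k : hom X A C) : rst f ;; rst f ;; k = rst f ;; k.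
Proof. rewrite <- compA, rst_idem. reflexivity. Qed.
Lemma R4_k A B C D (f : hom X A B) (g : hom X B C) (k : hom X B D) :
  f ;; rst g ;; k = rst (f ;; g) ;; f ;; k.
Proof. rewrite <- compA, R4, compA. reflexivity. Qed.
End ContinuationRules.

#[export] Hint Resolve total_comp total_pi0 total_pi1 total_id total_zero total_plus
  total_pair total_Rd : total.
Ltac solve_total := eauto 20 with total.

(* [simp] normalises a composite built from pairs, projections, zeros, sums
   and restrictions: it evaluates projections of pairs, removes restrictions
   of total maps, and pushes the remaining restrictions to the front (R.4). *)
Ltac simp_rules := rewrite ?compA, ?comp_id_l, ?comp_id_r, ?pair_pi0_k, ?pair_pi1_k,
  ?pair_pi0, ?pair_pi1, ?comp_pair_k, ?comp_pair, ?zero_pi1_k,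
  ?zero_pi0, ?zero_pi1, ?plus_pi1_k, ?plus_pi0, ?plus_pi1,
  ?comp_plus, ?plus_zero, ?plus_zero_l, ?pair_proj, ?rst_id, ?RD2_zero,
  ?R3, ?rst_idem_k, ?rst_idem, ?pair_eta, ?rst_pair, ?rst_comp_rst.
Ltac simp_total := repeat match goal with
  | |- context [rst ?f] => rewrite (total_rst (f := f)) by solve_total
  | |- context [comp ?x (comp (zero ?B ?C) ?k)] =>
      rewrite (comp_zero_total_k (x := x) k) by solve_total
  | |- context [comp ?x (zero ?B ?C)] => rewrite (comp_zero_total (x := x) C) by solve_total
  end.
Ltac not_rst x := lazymatch x with rst _ => fail | _ => idtac end.
Ltac simp_push_rst := repeat match goal with
  | |- context [comp ?x (comp (rst ?y) ?z)] => not_rst x; rewrite (R4_k x y z)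
  | |- context [comp ?x (rst ?y)] => not_rst x; rewrite (R4 x y)
  end.
Ltac simp := repeat (progress (simp_rules; simp_total; simp_push_rst)).
Ltac simpR := repeat (progress (rewrite ?RD3_0, ?RD3_1, ?Rd_id, ?RD1_zero, ?RD1_plus,
  ?RD4, ?RD5; simp_rules; simp_total; simp_push_rst)).
Ltac split_prod := repeat match goal with |- @eq (hom _ _ (prod _ _)) _ _ => apply prod_ext end.

Section DerivedProductLaws.
Context {X : BRDRC}.

Lemma pair_rst_r (A B C D : ob X) (k : hom X C D) (p : hom X C A) (q : hom X C B) :
  total p -> total q -> pair p (rst k ;; q) = rst k ;; pair p q.
Proof. intros Hp Hq. split_prod; simp; reflexivity. Qed.

Lemma tensor_id (A B : ob X) : tensor (idm A) (idm B) = idm (prod A B).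
Proof. unfold tensor. simp. reflexivity. Qed.

Lemma tensor_comp (A B C D E F : ob X) (f : hom X A C) (g : hom X B D)
  (h : hom X C E) (k : hom X D F) :
  total f -> total g -> total h -> total k ->
  tensor f g ;; tensor h k = tensor (f ;; h) (g ;; k).
Proof. intros Hf Hg Hh Hk. unfold tensor. split_prod; simp; reflexivity. Qed.
End DerivedProductLaws.

Section ReverseDerivative.
Context {X : BRDRC}.
Implicit Types A B C D : ob X.

Lemma Rd_tensor_pi1 A B C (k : hom X A B) :
  total k -> Rd (tensor k (idm C)) ;; pi1 = pi1 ;; pi1.
Proof. intro Hk. unfold tensor. simpR. reflexivity. Qed.

(* A reverse derivative evaluated at <p,q> is already restricted to the
   domain of G at p ([RD.8]). *)
Lemma Rd_absorb_rst A B C (G : hom X A B) (p : hom X C A) (q : hom X C B) :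
  total p -> total q -> rst (p ;; G) ;; pair p q ;; Rd G = pair p q ;; Rd G.
Proof.
  intros Hp Hq.
  assert (Hrst : pair p q ;; rst (Rd G) = rst (p ;; G) ;; pair p q).
  { rewrite RD8. simp. split_prod; simp; reflexivity. }
  rewrite <- compA, <- Hrst, compA, R1. reflexivity.
Qed.

Lemma Rd_comp_pi1 Z A B (G : hom X Z (prod A B)) :
  Rd (G ;; pi1) = pair pi0 (pi1 ;; pair (zero B A) (idm B)) ;; Rd G.
Proof.
  rewrite RD5, RD3_1, pair_pi1_k, pair_rst_r by solve_total.
  rewrite compA. apply Rd_absorb_rst; solve_total.
Qed.

Lemma Rd_pi1_invariant A C D (k : hom X A A) (g : hom X (prod A C) D) :
  total k -> g = tensor k (idm C) ;; g ->
  Rd g ;; pi1 = pair (pi0 ;; tensor k (idm C)) pi1 ;; Rd g ;; pi1.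
Proof.
  intros Hk Hg.
  transitivity (Rd (tensor k (idm C) ;; g) ;; pi1).
  { rewrite <- Hg. reflexivity. }
  rewrite RD5, compA, Rd_tensor_pi1 by exact Hk. simp. reflexivity.
Qed.
End ReverseDerivative.

Section DaggerOfD.
Context {X : BRDRC}.

(* Since R[f] is additive in its second argument ([RD.2]), its reverse
   derivative read in the linear coordinate does not depend on that
   argument: R[R[f]] pi1 at ((a,b),c) equals its value at ((a,0),c). *)
Lemma Rd_Rd_pi1_base_zero (A B : ob X) (f : hom X A B) :
  Rd (Rd f) ;; pi1 = tensor (pi0 ;; iota0 A B) (idm A) ;; Rd (Rd f) ;; pi1.
Proof.
  set (s := pair (@pi0 X A (prod B B)) (plus (pi1 ;; pi0) (pi1 ;; pi1))).
  set (u := pair (@pi0 X A (prod B B)) (pi1 ;; pi0)).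
  set (v := pair (@pi0 X A (prod B B)) (pi1 ;; pi1)).
  assert (Hs : Rd s ;; pi1 ;; pi1 = pi1 ;; pi1) by (subst s; simpR; reflexivity).
  assert (Hu : Rd u ;; pi1 ;; pi1 = zero _ B) by (subst u; simpR; reflexivity).
  assert (Hv : Rd v ;; pi1 ;; pi1 = pi1 ;; pi1) by (subst v; simpR; reflexivity).
  (* differentiate additivity s R[f] = u R[f] + v R[f] and evaluate at
     ((a,b),c) |-> ((a,(b,0)),c) *)
  assert (Hadd : Rd (s ;; Rd f) = plus (Rd (u ;; Rd f)) (Rd (v ;; Rd f))).
  { rewrite <- RD1_plus. f_equal. apply RD2_plus. }
  set (P := pair (pair (pi0 ;; pi0) (pair (pi0 ;; pi1) (zero _ B))) (@pi1 X (prod A B) A)).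
  apply (f_equal (fun z => P ;; z ;; pi1 ;; pi1)) in Hadd. simpl in Hadd.
  rewrite !RD5, !compA, Hs, comp_plus_k, plus_pi1_k, plus_pi1, !compA, Hu, Hv in Hadd.
  revert Hadd. subst P s u v. simp.
  rewrite comp_zero, rst_pair, total_rst, comp_id_l by solve_total.
  set (K := pair (pair (pi0 ;; pi0) (zero _ B)) (@pi1 X (prod A B) A)).
  intro Hadd.
  (* the restricted zero has the domain of R[R[f]], which ignores b ([RD.8]) *)
  assert (Hdom : rst (Rd (Rd f)) = rst (K ;; Rd (Rd f) ;; pi1)).
  { rewrite <- compA, rst_comp_total, <- rst_comp_rst, <- (rst_rst (Rd (Rd f))), !RD8
      by solve_total.
    subst K. simp. reflexivity. }
  etransitivity; [exact Hadd|].
  rewrite Hdom, rst_zero_plus. subst K. unfold tensor, iota0. simp. reflexivity.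
Qed.

Definition RD6_lhs {A B : ob X} (f : hom X A B) : hom X (prod A (prod B B)) A :=
  comp (comp (comp (pair (tensor (idm A) (@pi0 _ B B)) (tensor (zero A A) (@pi1 _ B B)))
                   (tensor (iota0 (prod A B) A) (idm (prod A B))))
             (Rd (Rd (Rd f))))
       pi1.

Lemma dagger_Dd_factor (A B : ob X) (f : hom X A B) :
  dagger (Dd f) = tensor (idm A) (pair (zero B B) (idm B)) ;; RD6_lhs f.
Proof.
  unfold Dd, dagger, RD6_lhs. rewrite !compA, RD5, Rd_comp_pi1, !compA.
  rewrite Rd_tensor_pi1 by (unfold iota0; solve_total).
  unfold tensor, iota0. simp. reflexivity.
Qed.

(* Writing L_f as
   N <pi0 K, pi1> R[R[R[f]] pi1] pi1, where K = (pi0 iota0) x 1 resets the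
   linear argument of R[f], this follows from [Rd_pi1_invariant] applied to
   [Rd_Rd_pi1_base_zero]; the prefix N <pi0 K, pi1> ignores the first
   B-coordinate. *)
Lemma RD6_lhs_second_only (A B : ob X) (f : hom X A B) :
  RD6_lhs f = tensor (idm A) (pi1 ;; pair (zero B B) (idm B)) ;; RD6_lhs f.
Proof.
  set (N := pair (pair (pair (@pi0 X A (prod B B)) (pi1 ;; pi0)) (zero _ A)) (pi1 ;; pi1)).
  set (K := tensor (@pi0 X A B ;; iota0 A B) (idm A)).
  assert (HN : RD6_lhs f = N ;; pair (pi0 ;; K) pi1 ;; Rd (Rd (Rd f) ;; pi1) ;; pi1).
  { transitivity (N ;; (pair pi0 (pi1 ;; pair (zero B A) (idm B)) ;; Rd (Rd (Rd f))) ;; pi1).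
    - unfold RD6_lhs. rewrite !compA, <- compA.
      assert (Hpre : pair (tensor (idm A) pi0) (tensor (zero A A) pi1)
                       ;; tensor (iota0 (prod A B) A) (idm (prod A B))
                     = N ;; pair pi0 (pi1 ;; pair (zero B A) (idm B))).
      { subst N. unfold tensor, iota0. split_prod; simp; reflexivity. }
      rewrite Hpre, !compA. reflexivity.
    - rewrite <- Rd_comp_pi1. f_equal. apply Rd_pi1_invariant.
      + unfold iota0; solve_total.
      + apply Rd_Rd_pi1_base_zero. }
  assert (HK : N ;; pair (pi0 ;; K) pi1
               = tensor (idm A) (pi1 ;; pair (zero B B) (idm B)) ;; N ;; pair (pi0 ;; K) pi1).
  { subst N K. unfold tensor, iota0. split_prod; simp; reflexivity. }
  transitivity ((N ;; pair (pi0 ;; K) pi1) ;; Rd (Rd (Rd f) ;; pi1) ;; pi1).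
  - rewrite HN, compA. reflexivity.
  - rewrite HK, HN, !compA. reflexivity.
Qed.
End DaggerOfD.

Theorem mainTheorem9 (X : BRDRC) :
  RD6 X <-> (forall (A B : ob X) (f : hom X A B), dagger (Dd f) = Rd f).
Proof.
  split.
  - intros HRD6 A B f.
    assert (Hsec : pair (zero B B) (idm B) ;; pi1 = idm B) by (simp; reflexivity).
    rewrite dagger_Dd_factor, (HRD6 A B f : RD6_lhs f = _), <- compA, tensor_comp, Hsec,
      comp_id_l, tensor_id by solve_total.
    apply comp_id_l.
  - intros Hdagger A B f.
    change (RD6_lhs f = tensor (idm A) pi1 ;; Rd f).
    assert (Hsplit : tensor (idm A) (@pi1 X B B ;; pair (zero B B) (idm B))
                     = tensor (idm A) pi1 ;; tensor (idm A) (pair (zero B B) (idm B))).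
    { rewrite tensor_comp, comp_id_l by solve_total. reflexivity. }
    rewrite RD6_lhs_second_only, Hsplit, compA, <- dagger_Dd_factor, Hdagger.
    reflexivity.
Qed.
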